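(* Let $A$ be a finite alphabet, $p$ a prime, $u\in A^*$ a non-empty word, $\mathfrak{M}\in\mathbb{F}_p[q]$ a polynomial of degree at least $1$, and let $\cong$ be a congruence on $A^*$ that refines $\sim_{u,\mathfrak{M}}$. If $q$ is not a unit of $\mathbb{K}=\mathbb{F}_p[q]/\langle\mathfrak{M}\rangle$, then the monoid $A^*/{\cong}$ is not a group. In particular, no element of $A^*/{\cong}$ except for the identity is invertible.
   Context: $A^*$ is the free monoid of finite words over $A$ (with concatenation and empty word $\varepsilon$), and $|w|$ is the length of a word $w$. The $q$-binomial coefficient $\binom{u}{v}_q\in\mathbb{N}[q]$ of two words $u,v\in A^*$ is defined recursively by $\binom{u}{\varepsilon}_q=1$, $\binom{\varepsilon}{v}_q=0$ if $v\neq\varepsilon$, and, for all $u,v\in A^*$ and letters $a,b\in A$, $\binom{ua}{vb}_q=q^{|vb|}\binom{u}{vb}_q+\delta_{a,b}\binom{u}{v}_q$, where $\delta_{a,b}$ is the Kronecker delta. The integer coefficients of $\binom{u}{v}_q$ are reduced modulo $p$ to view it in $\mathbb{F}_p[q]$. $\operatorname{Fac}(u)$ is the set of factors of $u$, i.e. the words $f$ with $u=xfs$ for some $x,s\in A^*$. Write $w_1\sim_{u,\mathfrak{M}}w_2$ if $\binom{w_1}{v}_q\equiv\binom{w_2}{v}_q\pmod{\mathfrak{M}}$ for all $v\in\operatorname{Fac}(u)$. A congruence on $A^*$ is an equivalence relation compatible with concatenation on both sides. An equivalence relation $\cong$ refines $\sim$ if $w_1\cong w_2$ implies $w_1\sim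 w_2$. *)

(* Defs.v *)
From HB Require Import structures.
From mathcomp Require Import all_boot all_order all_algebra.
From mathcomp Require Import boolp.

Set Implicit Arguments.
Unset Strict Implicit.
Unset Printing Implicit Defensive.

Import GRing.Theory.
Local Open Scope ring_scope.
Local Open Scope quotient_scope.

Section QBinomial.
Variable A : eqType.
Implicit Types u v w : seq A.

(* The defining recursion removes the LAST letters of u and v, so it is run on
   the mirror images of the words. *)
Fixpoint qbin_rev (u v : seq A) {struct u} : {poly nat} :=
  match v, u with
  | [::], _ => 1
  | _ :: _, [::] => 0
  | b :: v', a :: u' =>
      'X^(size v) * qbin_rev u' v + (a == b)%:R * qbin_rev u' v'
  end.

Definition qbin u v : {poly nat} := qbin_rev (rev u) (rev v).

Lemma qbin0 u : qbin u [::] = 1.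
Proof. by rewrite /qbin; case: (rev u). Qed.

Lemma qbin0l v : v != [::] -> qbin [::] v = 0.
Proof.
by case: (lastP v) => // v' b _; rewrite /qbin rev_rcons.
Qed.

Lemma qbin_rcons u v a b :
  qbin (rcons u a) (rcons v b) =
    'X^(size (rcons v b)) * qbin u (rcons v b) + (a == b)%:R * qbin u v.
Proof. by rewrite /qbin !rev_rcons /= size_rev size_rcons. Qed.

Definition qbin_mod (p : nat) u v : {poly 'F_p} :=
  map_poly (fun n : nat => n%:R) (qbin u v).

Definition qbin_equiv (p : nat) u (M : {poly 'F_p}) w1 w2 : Prop :=
  forall v, infix v u -> M %| qbin_mod p w1 v - qbin_mod p w2 v.

End QBinomial.

Section MonicAssociate.
Variable F : fieldType.
Implicit Types M f g : {poly F}.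

(* {poly %/ h} is the quotient by h only when h is monic of positive degree;
   M and its monic associate generate the same ideal. *)
Definition monic_assoc M : {poly F} := (lead_coef M)^-1 *: M.

Lemma monic_assoc_quotE M f g : (1 < size M)%N ->
  (in_qpoly (monic_assoc M) f == in_qpoly (monic_assoc M) g) = (M %| f - g).
Proof.
move=> sM.
have lM : lead_coef M != 0.
  by rewrite lead_coef_eq0 -size_poly_gt0 (leq_trans _ sM).
have mM : monic_assoc M \is monic.
  by rewrite monicE lead_coefZ mulVf.
have eM : mk_monic (monic_assoc M) = monic_assoc M.
  by rewrite /mk_monic mM size_scale ?invr_eq0 // sM.
rewrite -subr_eq0 -raddfB -val_eqE /= eM -Pdiv.IdomainMonic.modpE //.
by rewrite -/(_ %| _) dvdpZl ?invr_eq0.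
Qed.

End MonicAssociate.

Record congruence (A : Type) := Congruence {
  cong_rel :> seq A -> seq A -> Prop;
  cong_refl : forall w, cong_rel w w;
  cong_sym : forall w1 w2, cong_rel w1 w2 -> cong_rel w2 w1;
  cong_trans : forall w1 w2 w3,
    cong_rel w1 w2 -> cong_rel w2 w3 -> cong_rel w1 w3;
  cong_catl : forall x w1 w2, cong_rel w1 w2 -> cong_rel (x ++ w1) (x ++ w2);
  cong_catr : forall x w1 w2, cong_rel w1 w2 -> cong_rel (w1 ++ x) (w2 ++ x)
}.

Section WordQuotient.
Variables (A : choiceType) (R : congruence A).

Definition cong_bool : rel (seq A) := fun w1 w2 => `[< R w1 w2 >].

Lemma cong_bool_refl : reflexive cong_bool.
Proof. by move=> w; apply/asboolP/cong_refl. Qed.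

Lemma cong_bool_sym : symmetric cong_bool.
Proof. by move=> w1 w2; apply/asboolP/asboolP; apply: cong_sym. Qed.

Lemma cong_bool_trans : transitive cong_bool.
Proof.
move=> w2 w1 w3 /asboolP h1 /asboolP h2.
by apply/asboolP; apply: cong_trans h1 h2.
Qed.

Canonical cong_equiv :=
  EquivRel cong_bool cong_bool_refl cong_bool_sym cong_bool_trans.

Definition word_quot := {eq_quot cong_equiv}.
HB.instance Definition _ := Choice.on word_quot.
HB.instance Definition _ := EqQuotient.on word_quot.

Lemma word_quotP (w1 w2 : seq A) :
  \pi_word_quot w1 = \pi_word_quot w2 <-> R w1 w2.
Proof.
by split=> [/eqmodP/asboolP //|h]; apply/eqmodP/asboolP.
Qed.

Definition word_quot_one : word_quot := \pi_word_quot [::].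

Definition word_quot_mul (x y : word_quot) : word_quot :=
  \pi_word_quot (repr x ++ repr y).

Lemma word_quot_mulE (w1 w2 : seq A) :
  word_quot_mul (\pi_word_quot w1) (\pi_word_quot w2) =
    \pi_word_quot (w1 ++ w2).
Proof.
apply/word_quotP; apply: (@cong_trans _ _ _ (w1 ++ repr (\pi_word_quot w2))).
  by apply/cong_catr/word_quotP; rewrite reprK.
by apply/cong_catl/word_quotP; rewrite reprK.
Qed.

Lemma word_quot_mulA : associative word_quot_mul.
Proof.
move=> x y z; rewrite -{1}[x]reprK -[z]reprK.
rewrite [word_quot_mul y _](_ : _ = \pi_word_quot (repr y ++ repr z)).
  rewrite (word_quot_mulE (repr x)) catA.
  by rewrite [RHS](word_quot_mulE (repr x ++ repr y)).
by rewrite reprK.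
Qed.

Lemma word_quot_mul1l : left_id word_quot_one word_quot_mul.
Proof. by move=> x; rewrite -[x]reprK (word_quot_mulE [::]). Qed.

Lemma word_quot_mul1r : right_id word_quot_one word_quot_mul.
Proof. by move=> x; rewrite -[x]reprK (word_quot_mulE _ [::]) cats0. Qed.

HB.instance Definition _ := isMonoid.Build word_quot
  word_quot_mulA word_quot_mul1l word_quot_mul1r.

End WordQuotient.

Definition invertible (G : monoidType) (x : G) : Prop :=
  exists y : G, (x * y = 1)%g /\ (y * x = 1)%g.

Definition is_group (G : monoidType) : Prop := forall x : G, invertible x.

(* Main.v *)
Require Import Defs.
From mathcomp Require Import all_boot all_order all_algebra.

Import GRing.Theory.
Local Open Scope ring_scope.
Local Open Scope quotient_scope.

(** Only the empty word is congruent to the empty word. Indeed, let [w] be non-empty and congruent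
    to it, and let [a] be a letter of [u]; then [a :: w] is congruent to [[:: a]], and evaluating at
    the factor [[:: a]] forces q^|w| = 1 modulo [M], so q would be a unit ([cong_nil_unit_qX]). An
    invertible class then has only the empty word as representative, since a product of words is
    empty only if both factors are. *)

(** Each occurrence of [a] contributes q to the power of the number of letters to its right, and
    appending [w] raises this number by [size w] for the occurrences in [z]. *)
Lemma qbin_cat_letter (A : eqType) (z w : seq A) (a : A) :
  qbin (z ++ w) [:: a] = 'X^(size w) * qbin z [:: a] + qbin w [:: a].
Proof.
elim/last_ind: w => [|w b IHw].
  by rewrite cats0 expr0 mul1r qbin0l // addr0.
rewrite -rcons_cat -[[:: a]]/(rcons [::] a) !qbin_rcons !qbin0 IHw /= size_rcons.
by rewrite mulrDr mulrA -exprD add1n addrA.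
Qed.

Lemma qbin_mod_cons_letter (p : nat) (A : eqType) (w : seq A) (a : A) :
  qbin_mod p (a :: w) [:: a] = 'X^(size w) + qbin_mod p w [:: a].
Proof.
rewrite -cat1s /qbin_mod qbin_cat_letter.
have -> : qbin [:: a] [:: a] = 1.
  by rewrite /qbin /= eqxx mulr0 add0r mul1r.
apply/polyP => i; rewrite mulr1 coefD !coef_map_id0 // coefD natrD !coefXn.
by case: (i == _).
Qed.

(** The inverse of q is its power of exponent [n - 1]. *)
Lemma unit_qX (F : fieldType) (M : {poly F}) (n : nat) :
  (1 < size M)%N -> (0 < n)%N -> M %| 'X^n - 1 ->
  ('qX : {poly %/ monic_assoc M}) \is a GRing.unit.
Proof.
case: n => // n sM _.
rewrite -monic_assoc_quotE // rmorphXn rmorph1 /= exprS => /eqP qXn.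
by apply/unitrPr; exists ('qX ^+ n).
Qed.

(* Comparing a :: w with [:: a] at the factor [:: a]: the suffix w shifts the
   contribution of the first letter by 'X^(size w), which is thus 1 modulo M. *)
Lemma cong_nil_unit_qX (A : eqType) (p : nat) (u w : seq A) (a : A)
    (M : {poly 'F_p}) (R : congruence A) :
  (1 < size M)%N -> a \in u ->
  (forall w1 w2 : seq A, R w1 w2 -> qbin_equiv u M w1 w2) ->
  w != [::] -> R w [::] ->
  ('qX : {poly %/ monic_assoc M}) \is a GRing.unit.
Proof.
move=> sM au R_refines w0 Rw.
have a_infix : infix [:: a] u.
  by case/splitPr: au => u1 u2; apply/infixP; exists u1, u2.
have dvd_w := R_refines _ _ Rw _ a_infix.
have dvd_aw := R_refines _ _ (cong_catl [:: a] Rw) _ a_infix.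
apply: (@unit_qX _ _ (size w)) => //; first by rewrite lt0n size_eq0.
(* The difference regroups as ['X^(size w) - 1] plus the difference for [w] and [[::]], which [M]
   divides by [dvd_w]. *)
move: dvd_aw; rewrite /= !qbin_mod_cons_letter expr0 opprD addrACA.
by rewrite dvdp_addl.
Qed.

Theorem proposition6p11 (A : finType) (p : nat) (p_prime : prime p)
    (u : seq A) (u_nonempty : u <> [::])
    (M : {poly 'F_p}) (M_deg : (1 < size M)%N)
    (R : congruence A)
    (R_refines : forall w1 w2 : seq A, R w1 w2 -> qbin_equiv u M w1 w2)
    (q_nonunit : ('qX : {poly %/ monic_assoc M}) \isn't a GRing.unit) :
  ~ is_group (word_quot R) /\
  (forall x : word_quot R, invertible x -> x = 1%g).
Proof.
have [a au] : exists a, a \in u.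
  by case: u u_nonempty {R_refines} => // a u' _; exists a; rewrite mem_head.
have nil_only w : R w [::] -> w = [::].
  move=> Rw; apply/eqP; apply: contraNT q_nonunit => w0.
  exact: cong_nil_unit_qX M_deg au R_refines w0 Rw.
have inv_nil w : invertible (\pi_(word_quot R) w) -> w = [::].
  (* A right inverse suffices: [w ++ repr y] is congruent to [[::]], hence empty. *)
  case=> y [+ _]; rewrite -[y]reprK [(_ * _)%g]word_quot_mulE.
  by move=> /word_quotP /nil_only; case: w.
split=> [G|x]; first by have := inv_nil [:: a] (G _).
by rewrite -[x]reprK => /inv_nil ->.
Qed.
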